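(* Let $(X,d)$ be a complete metric space with $X$ nonempty and let $T:X\to X$ be a map. Let $a,b\in[0,\infty[$ be numbers and $K:[0,\infty[\to[0,\infty[$ a function such that $$d(Tx,Ty)\le a\,d(x,y)+b\,[d(x,Tx)+d(y,Ty)]+K(d(Tx,y))\quad\text{for all } x,y\in X,$$ and such that $a+2b<1$, $K(0)=0$, and $K(t)\to 0$ as $t\to 0$. Then $T$ is a strong Picard operator (modulo $d$).
   Context: Write $\mathrm{Fix}(T)=\{x\in X: x=Tx\}$. The map $T$ is a strong Picard operator (modulo $d$) if for each $x\in X$ the sequence of iterates $(T^nx)_{n\ge0}$ converges with respect to $d$ and its limit belongs to $\mathrm{Fix}(T)$. *)

(* Defs.v *)
From HB Require Import structures.
From mathcomp Require Import all_boot all_order all_algebra.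
From mathcomp Require Import all_classical all_reals all_analysis.

Set Implicit Arguments.
Unset Strict Implicit.
Unset Printing Implicit Defensive.

Import Order.TTheory GRing.Theory Num.Theory.
Import numFieldNormedType.Exports.

Local Open Scope classical_set_scope.
Local Open Scope ring_scope.

(* Nonemptiness is built in: Complete extends Pointed. *)
#[short(type="completeMetricType")]
HB.structure Definition CompleteMetric (R : numDomainType) :=
  { X of Complete X & Metric R X }.

Definition Fixset (X : Type) (T : X -> X) : set X := [set x | x = T x].

(* The topology of a metricType is the one generated by the mdist-balls, so
   --> is convergence with respect to mdist; limits are unique
   (metric_hausdorff). *)
Definition strong_Picard (R : realType) (X : metricType R) (T : X -> X) :=
  forall x : X, exists2 l : X,
    iter n T x @[n --> \oo] --> l & Fixset T l.

(* Main.v *)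
Require Import Defs.
From mathcomp Require Import all_boot all_order all_algebra.
From mathcomp Require Import all_classical all_reals all_analysis.
From mathcomp Require Import lra.

(** Apply the contraction condition to two consecutive iterates u_n and
    u_(n+1) = T u_n. The last term is K(d(T u_n, u_(n+1))) = K(0) = 0, so with
    e_n = d(u_n, u_(n+1)) the condition reads
    e_(n+1) <= a e_n + b (e_n + e_(n+1)), that is, e_(n+1) <= q e_n for
    q = (a + b) / (1 - b), and q < 1 is the hypothesis a + 2b < 1. Hence e_n
    tends to 0 ([ratio_cvg0]) and the steps are dominated by a convergent
    geometric series, so the iterates form a Cauchy sequence
    ([telescope_cvg]); call l its limit.

    To see that l is fixed, apply the condition to u_n and l:
    d(u_(n+1), T l) <= a d(u_n, l) + b (e_n + d(l, T l)) + K(d(u_(n+1), l)).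
    The last term tends to 0 because its argument does ([cvg_comp_right0]).
    In the limit d(l, T l) <= b d(l, T l), and b < 1 forces d(l, T l) = 0. *)

Set Implicit Arguments.
Unset Strict Implicit.
Unset Printing Implicit Defensive.

Import Order.TTheory GRing.Theory Num.Theory.
Import numFieldNormedType.Exports.

Local Open Scope classical_set_scope.
Local Open Scope ring_scope.

Lemma ratio_cvg0 (R : realType) (e : nat -> R) (q : R) :
  0 <= q -> q < 1 -> (forall n, 0 <= e n) -> (forall n, e n.+1 <= q * e n) ->
  e n @[n --> \oo] --> 0.
Proof.
move=> q0 q1 e0 eq.
have le_geo n : e n <= geometric (e 0%N) q n.
  elim: n => [|n IHn]; first by rewrite /= expr0 mulr1.
  apply: (le_trans (eq n)).
  by rewrite /= exprS mulrCA ler_wpM2l.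
apply: (@squeeze_cvgr _ _ _ _ (cst 0) (geometric (e 0%N) q)).
- by apply: nearW => n; rewrite e0 le_geo.
- exact: cvg_cst.
- by apply: cvg_geometric; rewrite ger0_norm.
Qed.

Lemma mdist_telescope (R : realType) (X : metricType R) (u : nat -> X)
    (v : nat -> R) :
  (forall n, mdist (u n) (u n.+1) <= v n - v n.+1) ->
  forall n k, mdist (u n) (u (n + k)%N) <= v n - v (n + k)%N.
Proof.
move=> uv n; elim=> [|k IHk]; first by rewrite addn0 mdistxx subrr.
rewrite addnS (le_trans (metric_triangle _ (u (n + k)%N) _))//.
by rewrite (le_trans (lerD IHk (uv _)))// addrA subrK.
Qed.

(** By telescoping, all terms of rank at least N lie within [v N] of [u N], so
    that the sequence is Cauchy as soon as [v] tends to 0; it is enough that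
    each ball of the Cauchy condition be centred at a single term [u N]. *)
Lemma telescope_cvg (R : realType) (X : completeMetricType R) (u : nat -> X)
    (v : nat -> R) :
  (forall n, 0 <= v n) -> v n @[n --> \oo] --> 0 ->
  (forall n, mdist (u n) (u n.+1) <= v n - v n.+1) ->
  cvg (u n @[n --> \oo]).
Proof.
move=> v0 vcvg uv; apply: cauchy_cvg; apply: cauchy_exP => e e0.
have [N _ vNe] : \forall n \near \oo, v n < e by exact: cvgr_lt vcvg _ e0.
exists (u N), N => // n /= /subnKC <-.
rewrite ballEmdist /= (le_lt_trans (mdist_telescope uv _ _))//.
by rewrite (le_lt_trans _ (vNe N (leqnn N)))// lerBlDr lerDl.
Qed.

Lemma cvg_mdist0 (R : realType) (X : metricType R) (I : Type)
    (F : set_system I) {FF : Filter F} (u : I -> X) (l : X) :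
  u i @[i --> F] --> l -> mdist (u i) l @[i --> F] --> 0.
Proof.
move=> ul; apply/cvgr0Pnorm_lt => e e0.
near=> i.
rewrite ger0_norm ?mdist_ge0// metric_sym.
by near: i; apply: metricType_numDomainType.cvgr_dist_lt ul _ e0.
Unshelve. all: by end_near. Qed.

(** The limit from the right ignores the value at the point itself, and a
    nonnegative family may tend to 0 while vanishing infinitely often; the
    normalisation [K 0 = 0] is what covers those indices. *)
Lemma cvg_comp_right0 (R : realType) (K : R -> R) (I : Type)
    (F : set_system I) {FF : Filter F} (e : I -> R) :
  K 0 = 0 -> K t @[t --> 0^'+] --> 0 ->
  (forall i, 0 <= e i) -> e i @[i --> F] --> 0 ->
  K (e i) @[i --> F] --> 0.
Proof.
move=> K0 /cvgr0Pnorm_lt K_cvg e0 e_cvg; apply/cvgr0Pnorm_lt => eps eps0.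
have [d /= d0 Kd] := K_cvg _ eps0.
near=> i.
have [ei0|ei0] := eqVneq (e i) 0; first by rewrite ei0 K0 normr0.
apply: Kd; last by rewrite lt_def ei0 e0.
rewrite /= sub0r normrN.
by near: i; exact: cvgr0_norm_lt e_cvg _ d0.
Unshelve. all: by end_near. Qed.

Theorem theorem5 (R : realType) (X : completeMetricType R) (T : X -> X)
    (a b : R) (K : R -> R)
    (a_ge0 : 0 <= a) (b_ge0 : 0 <= b)
    (K_ge0 : forall t : R, 0 <= t -> 0 <= K t)
    (contr : forall x y : X,
      mdist (T x) (T y) <=
        a * mdist x y + b * (mdist x (T x) + mdist y (T y))
        + K (mdist (T x) y))
    (ab_lt1 : a + 2 * b < 1)
    (K0 : K 0 = 0)
    (K_cvg0 : K t @[t --> 0^'+] --> 0) :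
  strong_Picard T.
Proof.
move=> x.
have b_lt1 : 0 < 1 - b by lra.
pose u n := iter n T x.
pose e n := mdist (u n) (u n.+1).
have e_ge0 n : 0 <= e n by exact: mdist_ge0.
pose q := (a + b) / (1 - b).
have q_ge0 : 0 <= q by apply: divr_ge0; [exact: addr_ge0 | exact: ltW].
have q_lt1 : 0 < 1 - q by rewrite subr_gt0 ltr_pdivrMr// mul1r; lra.
(* At the pair (u_n, u_(n+1)) the argument of [K] is d(T u_n, u_(n+1)) = 0, and
   the condition becomes (1 - b) e_(n+1) <= (a + b) e_n. *)
have e_ratio n : e n.+1 <= q * e n.
  rewrite /q mulrAC ler_pdivlMr//.
  have := contr (u n) (u n.+1).
  rewrite -[T (u n)]/(u n.+1) -[T (u n.+1)]/(u n.+2) mdistxx K0.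
  rewrite -/(e n) -/(e n.+1); lra.
have e_cvg : e n @[n --> \oo] --> 0.
  by apply: (ratio_cvg0 q_ge0 _ e_ge0 e_ratio); rewrite -subr_gt0.
(* e_(n+1) <= q e_n says exactly that e_n <= v_n - v_(n+1); v_n is the sum of the
   geometric series that dominates the distances from the n-th step on. *)
pose v n := e n / (1 - q).
have /cvg_ex[l ul] : cvg (u n @[n --> \oo]).
  apply: (@telescope_cvg _ _ _ v) => [n||n].
  - by rewrite divr_ge0// ltW.
  - by rewrite -(mul0r (1 - q)^-1); apply: cvgMr_tmp.
  - rewrite -mulrBl ler_pdivlMr// -/(e n); have := e_ratio n; lra.
exists l => //.
have d_cvg : mdist (u n) l @[n --> \oo] --> 0 by exact: cvg_mdist0.
have dS_cvg : mdist (u n.+1) l @[n --> \oo] --> 0.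
  by rewrite (cvg_shiftS (fun n => mdist (u n) l)).
have K_d_cvg : K (mdist (u n.+1) l) @[n --> \oo] --> 0.
  by apply: cvg_comp_right0 => // n; exact: mdist_ge0.
(* [s n] collects the terms that vanish in the limit when d(l, T l) is bounded
   by d(l, u_(n+1)) + d(T u_n, T l) and the contraction condition is applied to
   u_n and l; the term b d(l, T l) remains, whence the factor 1 - b below. *)
pose s n :=
  mdist (u n.+1) l + a * mdist (u n) l + b * e n + K (mdist (u n.+1) l).
have s_cvg : s n @[n --> \oo] --> 0.
  have -> : 0 = 0 + a * 0 + b * 0 + 0 :> R by rewrite !mulr0 !addr0.
  by apply: cvgD => //; apply: cvgD; [apply: cvgD => //|]; apply: cvgMl_tmp.
have le_s n : (1 - b) * mdist l (T l) <= s n.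
  have := metric_triangle l (u n.+1) (T l).
  have := contr (u n) l.
  rewrite -[T (u n)]/(u n.+1) -/(e n) [mdist l (u n.+1)]metric_sym /s; lra.
have : (1 - b) * mdist l (T l) <= 0.
  rewrite -(cvg_lim _ s_cvg)//; apply: limr_ge; first by apply/cvg_ex; exists 0.
  exact: nearW.
rewrite pmulr_rle0// => Tl.
by apply: mdist_positivity; apply/eqP; rewrite eq_le Tl mdist_ge0.
Qed.
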